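(* Let $p(x)\in\mathbb{Z}[x]$ be a polynomial with even degree, with simple roots belonging to the set $\left\{\ldots,-3,-2,-1,\tfrac12,\tfrac32,\tfrac52,\ldots\right\}$, and such that $p(x)=p\left(-\tfrac12-x\right)$. Then $$ \sum_{n\geq 0}(-1)^n\frac{4n+1}{p(n)}\left[\frac{1}{4^n}\binom{2n}{n}\right]^3 $$ is a rational multiple of $\frac{1}{\pi}$, and $$ \sum_{n\geq 0}\frac{4n+1}{p(n)^2}\left[\frac{1}{4^n}\binom{2n}{n}\right]^4,\qquad \sum_{n\geq 0}\frac{4n+1}{p(n)}\left[\frac{1}{4^n}\binom{2n}{n}\right]^4 $$ are rational multiples of $\frac{1}{\pi^2}$.
   Context: The set of admissible roots consists of all negative integers together with all positive half-integers $\tfrac12,\tfrac32,\tfrac52,\ldots$. A rational multiple of a real number $c$ means a number of the form $qc$ with $q\in\mathbb{Q}$.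
   Formalization: The claims about the two series with fourth powers are made only for nonconstant p(x), since for nonzero constant p(x) both series diverge; the alternating series is treated for every p(x). *)

(* Defs.v *)
From HB Require Import structures.
From mathcomp Require Import all_boot all_order all_algebra.
From mathcomp Require Import complex.
From mathcomp Require Import all_classical all_reals all_analysis.

Set Implicit Arguments.
Unset Strict Implicit.
Unset Printing Implicit Defensive.

Import Order.TTheory GRing.Theory Num.Theory.
Import numFieldNormedType.Exports.
Local Open Scope classical_set_scope.
Local Open Scope ring_scope.

Definition admissible (R : realType) (z : R[i]) : Prop :=
  (exists m : nat, z = - m.+1%:R) \/ (exists m : nat, z = m%:R + 2^-1).

(* All complex roots are constrained, not just the real ones. The zero
   polynomial is excluded, since its root 0 is not admissible. *)
Definition simple_admissible_roots (R : realType) (p : {poly int}) : Prop :=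
  forall z : R[i], root (map_poly intr p) z ->
    mup z (map_poly intr p) = 1%N /\ admissible z.

(* p(x) = p(- 1/2 - x), as an identity in Q[x]. *)
Definition reflection_invariant (p : {poly int}) : Prop :=
  let pQ : {poly rat} := map_poly intr p in
  pQ = pQ \Po (- (2^-1)%:P - 'X).

Definition central_ratio (R : realType) (n : nat) : R :=
  (4 ^+ n)^-1 * 'C((2 * n)%N, n)%:R.

Definition cubic_term (R : realType) (p : {poly int}) (n : nat) : R :=
  (-1) ^+ n * ((4 * n + 1)%N%:R / (p.[n%:Z])%:~R) * central_ratio R n ^+ 3.

Definition quartic_term (R : realType) (p : {poly int}) (k n : nat) : R :=
  (4 * n + 1)%N%:R / (p.[n%:Z])%:~R ^+ k * central_ratio R n ^+ 4.

Definition rational_multiple (R : realType) (c x : R) : Prop :=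
  exists q : rat, x = ratr q * c.

(* The series is only required to converge as a limit of its partial sums:
   the alternating one converges only conditionally when p is constant. *)
Definition sum_is_rational_multiple (R : realType) (u : R^nat) (c : R) : Prop :=
  cvgn (series u) /\ rational_multiple c (limn (series u)).

(* Main.v *)
(* Write a_n = C(2n,n)/4^n and D_m(n) = (n+m)(n-m+1/2). The reflection pairs the
   root -m with m-1/2, so p(n) = c * prod_{m in S} D_m(n), and since D_m - D_k
   does not depend on n, partial fractions reduce everything to the poles 1/D_m
   and 1/D_m^2. For these, the telescoping sequences n^4 a_n^4 r_m(n),
   n^4 a_n^4 r_m(n)^2 and (-1)^n n^3 a_n^3 r_m(n), where
   1/r_m(n) = (n-m+1/2)(n+m-1), express the pole of index m rationally through
   the one of index m-1 (with coefficient 0 when m = 1) and a boundary value at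
   infinity, which is 1/pi^2 or 0 by Wallis' formula. In the cubic case there
   remains Bauer's series sum (-1)^n (4n+1) a_n^3 = 2/pi, obtained from a WZ pair
   in an auxiliary parameter M by letting M tend to infinity. *)
Require Import Defs.
From HB Require Import structures.
From mathcomp Require Import all_boot all_order all_algebra.
From mathcomp Require Import complex ring lra zify.
From mathcomp Require Import all_classical all_reals all_analysis.
Import Order.TTheory GRing.Theory Num.Theory.
Import numFieldNormedType.Exports.
Local Open Scope classical_set_scope.
Local Open Scope ring_scope.

(** * Wallis' formula *)

Lemma central_ratio0 (R : realType) : central_ratio R 0 = 1.
Proof. by rewrite /central_ratio muln0 bin0 expr0 invr1 mulr1. Qed.

Lemma central_ratioS (R : realType) n :
  central_ratio R n.+1 = central_ratio R n * ((2 * n%:R + 1) / (2 * n%:R + 2)).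
Proof.
have e : (n.+1 * 'C(2 * n.+1, n.+1) = 2 * ((2 * n).+1 * 'C(2 * n, n)))%N.
  have := mul_bin_diag (2 * n).+2 n; have := mul_bin_down (2 * n).+1 n.
  rewrite mulnS /= (_ : (2 * n).+1 - n = n.+1)%N; last by lia.
  by move=> -> <-; rewrite mulnA; congr (_ * _)%N; lia.
have {e} /(congr1 (fun k => k%:R : R)) := e.
rewrite !natrM -!natr1 !natrM => e.
have n1 : n%:R + 1 != 0 :> R by rewrite natr1 pnatr_eq0.
have p4 : 4 ^+ n != 0 :> R by rewrite expf_neq0// pnatr_eq0.
rewrite /central_ratio exprS.
apply: (mulfI n1); rewrite mulrCA e.
field.
by rewrite p4 andbT -natrM -natrD pnatr_eq0 addn_eq0 andbF.
Qed.

Lemma central_ratio_gt0 (R : realType) n : 0 < central_ratio R n.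
Proof.
by rewrite /central_ratio mulr_gt0 ?invr_gt0 ?exprn_gt0 ?ltr0n ?bin_gt0//; lia.
Qed.

Lemma central_ratio_le1 (R : realType) n : central_ratio R n <= 1.
Proof.
elim: n => [|n IHn]; first by rewrite central_ratio0.
have an0 := central_ratio_gt0 R n; have n0 : 0 <= n%:R :> R by [].
rewrite central_ratioS (le_trans _ IHn)// ler_piMr ?(ltW an0)//.
by rewrite ler_pdivrMr; lra.
Qed.

(** An antiderivative of [sin x ^+ n], given by the reduction formula of integration by parts, so
    that Wallis integrals need only derivatives. *)
Fixpoint sin_primitive {R : realType} n (x : R) : R :=
  match n with
  | 0 => x
  | 1 => - cos x
  | k.+2 => (k.+1%:R * sin_primitive k x - cos x * sin x ^+ k.+1) / k.+2%:R
  end.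

Lemma is_derive_sin_primitive (R : realType) n (x : R) :
  is_derive x 1 (sin_primitive n) (sin x ^+ n).
Proof.
have [k] := ubnP n; elim: k n => // k IHk [|[|n]] nk.
- exact: is_derive_id (x : R^o) 1.
- by rewrite (_ : sin_primitive 1 = - cos)//; apply: is_derive_eq; rewrite opprK expr1.
have IH : is_derive x 1 (sin_primitive n) (sin x ^+ n) by apply: IHk; lia.
rewrite (_ : sin_primitive n.+2 = (n.+2%:R^-1) *:
  ((n.+1%:R *: sin_primitive n) - (cos * (sin ^+ n.+1)))); last first.
  by apply/funext => y; rewrite !fctE [LHS]mulrC.
apply: is_derive_eq.
rewrite !fctE /GRing.scale /=.
have e2 : n.+2%:R != 0 :> R by rewrite pnatr_eq0.
apply: (mulfI e2); rewrite mulVKf// !exprS -!natr1.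
have hc : cos x ^+ 2 = 1 - sin x ^+ 2 by rewrite -(cos2Dsin2 x) addrK.
ring: hc.
Qed.

(** The integral of sin^n over [0, pi/2], as a difference of primitive values. *)
Definition wallis_integral (R : realType) n : R :=
  sin_primitive n (pi / 2) - sin_primitive n 0.

Lemma wallis_integralSS (R : realType) n :
  wallis_integral R n.+2 = n.+1%:R / n.+2%:R * wallis_integral R n.
Proof.
by rewrite /wallis_integral /= cos_pihalf sin0 !mul0r expr0n mulr0; ring.
Qed.

(** On [0, pi/2] the sine lies in [0, 1], so sin^n - sin^(n+1) is nonnegative there and its
    primitive [f] is nondecreasing. *)
Lemma wallis_integral_le (R : realType) n :
  wallis_integral R n.+1 <= wallis_integral R n.
Proof.
pose f : R -> R := sin_primitive n - sin_primitive n.+1.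
have pi0 := pi_gt0 R.
have df (x : R) : is_derive x 1 f (sin x ^+ n - sin x ^+ n.+1).
  by have ? := is_derive_sin_primitive R n x;
     have ? := is_derive_sin_primitive R n.+1 x; apply: is_derive_eq.
suff : f 0 <= f (pi / 2) by rewrite /f !fctE /wallis_integral; lra.
apply: (@ger0_derive1_ndecr R f 0 (pi / 2)) => //; last by lra.
- move=> x; rewrite in_itv /= => /andP[x0 xpi]; rewrite derive1E derive_val.
  have s0 : 0 <= sin x by apply: sin_ge0_pi; lra.
  by rewrite subr_ge0 exprSr ler_piMr ?exprn_ge0// sin_le1.
- apply: continuous_subspaceT => x.
  by apply: differentiable_continuous; apply/derivable1_diffP; exact: ex_derive.
Qed.

Lemma wallis_integral_even (R : realType) n :
  wallis_integral R (2 * n) = pi / 2 * central_ratio R n.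
Proof.
elim: n => [|n IHn].
  by rewrite muln0 /wallis_integral /= central_ratio0; ring.
rewrite mulnS wallis_integralSS IHn central_ratioS -!natr1 natrM.
field.
by have := ler0n R n => n0; rewrite lt0r_neq0//; lra.
Qed.

Lemma wallis_integral_odd (R : realType) n :
  wallis_integral R (2 * n).+1 * ((2 * n%:R + 1) * central_ratio R n) = 1.
Proof.
elim: n => [|n IHn].
  by rewrite muln0 /wallis_integral /= central_ratio0 cos0 cos_pihalf; ring.
rewrite mulnS wallis_integralSS central_ratioS -[RHS]IHn -!natr1 natrM.
field.
by have := ler0n R n => n0; rewrite !lt0r_neq0//; lra.
Qed.

Lemma cvg_natr_shift_ratio (R : realType) (c : R) :
  n%:R / (n%:R + c) @[n --> \oo] --> (1 : R).
Proof.
rewrite -cvg_shiftS /=.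
have -> : (fun n => n.+1%:R / (n.+1%:R + c)) = (fun n => (1 + c * harmonic n)^-1).
  apply/funext => n; rewrite -invf_div mulrDl divff ?pnatr_eq0//.
suff h : (1 + c * harmonic n)^-1 @[n --> \oo] --> (1 + c * 0 : R)^-1.
  by rewrite mulr0 addr0 invr1 in h.
apply: cvgV; first by rewrite mulr0 addr0 oner_neq0.
by apply: cvgD; [exact: cvg_cst | apply: cvgMl_tmp; exact: cvg_harmonic].
Qed.

(** Multiplying I_(2n+2) <= I_(2n+1) <= I_(2n) by (2n+1) a_n turns the middle term into 1 and
    squeezes (2n+1) a_n^2 between 2/pi and (2/pi)(n+1)/(n+1/2). *)
Lemma wallis (R : realType) :
  (2 * n%:R + 1) * central_ratio R n ^+ 2 @[n --> \oo] --> (2 / pi : R).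
Proof.
have pi0 := pi_gt0 R.
apply: (@squeeze_cvgr _ _ _ _ (fun=> 2 / pi)
          (fun n => 2 / pi * (n.+1%:R / (n.+1%:R + (- 2^-1))))).
- apply: nearW => n; have a0 := central_ratio_gt0 R n.
  have n0 : 0 <= n%:R :> R by [].
  have oddE := wallis_integral_odd R n.
  have evenE := wallis_integral_even R n.
  have := wallis_integral_le R (2 * n); rewrite evenE => leO.
  have := wallis_integral_le R (2 * n).+1; rewrite wallis_integralSS evenE => leE.
  have T0 : 0 < (2 * n%:R + 1) * central_ratio R n by rewrite mulr_gt0//; lra.
  apply/andP; split.
    rewrite ler_pdivrMr//; have := ler_wpM2r (ltW T0) leO; rewrite oddE; nra.
  have := ler_wpM2r (ltW T0) leE; rewrite oddE.
  rewrite -[(2 * n).+2]addn2 -[(2 * n).+1]addn1 (natrD _ _ 2) (natrD _ _ 1) natrM => h.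
  have k0 : 0 < pi / 2 * ((2 * n%:R + 1) / (2 * n%:R + 2)) :> R.
    by rewrite !mulr_gt0 ?invr_gt0//; lra.
  have -> : 2 / pi * (n.+1%:R / (n.+1%:R - 2^-1)) =
            1 / (pi / 2 * ((2 * n%:R + 1) / (2 * n%:R + 2))) :> R.
    by rewrite -natr1; field; rewrite !lt0r_neq0//; lra.
  rewrite ler_pdivlMr//; apply: le_trans h; rewrite le_eqVlt; apply/orP; left.
  by apply/eqP; field; rewrite !lt0r_neq0//; lra.
- exact: cvg_cst.
- suff h : 2 / pi * (n.+1%:R / (n.+1%:R + (- 2^-1)))
      @[n --> \oo] --> 2 / pi * (1 : R) by rewrite mulr1 in h.
  apply: cvgMl_tmp.
  have := cvg_natr_shift_ratio R (- 2^-1).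
  by rewrite -cvg_shiftS.
Qed.

(** * Bauer's series *)

Lemma cvg_natr_central_ratio_sqr (R : realType) :
  n%:R * central_ratio R n ^+ 2 @[n --> \oo] --> (pi^-1 : R).
Proof.
suff h : (2^-1 * (n%:R / (n%:R + 2^-1)) *
    ((2 * n%:R + 1) * central_ratio R n ^+ 2)) @[n --> \oo]
    --> (2^-1 * 1 * (2 / pi) : R).
  rewrite mulr1 mulKf ?pnatr_eq0// in h.
  rewrite (_ : (fun n => _) = (fun n => 2^-1 * (n%:R / (n%:R + 2^-1)) *
    ((2 * n%:R + 1) * central_ratio R n ^+ 2)))//.
  apply/funext => n; have := ler0n R n => n0.
  by field; rewrite !lt0r_neq0//; lra.
apply: cvgM; last exact: wallis.
by apply: cvgMl_tmp; exact: cvg_natr_shift_ratio.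
Qed.

Lemma cvg_central_ratio0 (R : realType) : central_ratio R @ \oo --> 0.
Proof.
have h : central_ratio R n ^+ 2 @[n --> \oo] --> (0 : R).
  rewrite -(mulr0 (pi^-1)) -cvg_shiftS /=.
  rewrite (_ : (fun n => _) =
      (fun n => n.+1%:R * central_ratio R n.+1 ^+ 2 * harmonic n)).
    apply: cvgM; last exact: cvg_harmonic.
    by have := cvg_natr_central_ratio_sqr R; rewrite -cvg_shiftS.
  by apply/funext => n; rewrite /= mulrAC divff ?mul1r// pnatr_eq0.
rewrite (_ : central_ratio R = (fun n => Num.sqrt (central_ratio R n ^+ 2))).
  rewrite -[X in _ --> X]sqrtr0.
  exact: (cvg_comp _ _ h (@sqrt_continuous R 0)).
apply/funext => n; rewrite sqrtr_sqr ger0_norm// ltW//; exact: central_ratio_gt0.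
Qed.

(* A multiple, depending on M only, of the very-well-poised 4F3(-1) summand with
   a = M + 1/2 and b = c = 1/2; M = 0 is Bauer's series. *)
Definition bauer_term (R : realType) (M k : nat) : R :=
  (-1) ^+ k * (2 * M%:R + 4 * k%:R + 1) *
  (central_ratio R M * central_ratio R (M + k) * central_ratio R k ^+ 2) /
  'C(M + k, k)%:R.

(** The WZ mate of [bauer_term]: the linear factor 2M+4k+1 becomes 2k, so it vanishes at k = 0. *)
Definition bauer_cert (R : realType) (M k : nat) : R :=
  (-1) ^+ k * (2 * k%:R) *
  (central_ratio R M * central_ratio R (M + k) * central_ratio R k ^+ 2) /
  'C(M + k, k)%:R.

Lemma bauer_wz (R : realType) M k :
  bauer_term R M.+1 k - bauer_term R M k =
  bauer_cert R M k.+1 - bauer_cert R M k.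
Proof.
have /(congr1 (fun k => k%:R : R)) := mul_bin_down (M + k).+1 k.
have /(congr1 (fun k => k%:R : R)) := mul_bin_diag (M + k).+1 k.
rewrite /= (_ : (M + k).+1 - k = M.+1)%N; last by lia.
rewrite /bauer_term /bauer_cert addSn addnS !central_ratioS (exprS (-1) k).
rewrite !natrM -(natr1 (M + k)) -(natr1 M) -(natr1 k) natrD.
have c0 : 'C(M + k, k)%:R != 0 :> R.
  by rewrite pnatr_eq0 -lt0n bin_gt0 leq_addl.
have M0 := ler0n R M; have k0 := ler0n R k.
have m1 : M%:R + 1 != 0 :> R by rewrite lt0r_neq0//; lra.
have k1 : k%:R + 1 != 0 :> R by rewrite lt0r_neq0//; lra.
(* Both shifted binomials are now expressed through C(M+k, k), which leaves an identity of rational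
   functions in M and k. *)
move=> /esym /(canRL (mulKf k1)) -> /esym /(canRL (mulKf m1)) ->.
field.
by rewrite c0 !lt0r_neq0//; lra.
Qed.

(** Since a_M <= 1 and the binomial is at least 1, the absolute value is at most 2 (n a_n^2)
    a_(n+M), a convergent sequence times a null one. *)
Lemma cvg_bauer_cert0 (R : realType) M : bauer_cert R M @ \oo --> 0.
Proof.
apply/norm_cvg0P.
have h : 2 * (n%:R * central_ratio R n ^+ 2) * central_ratio R (n + M)
    @[n --> \oo] --> (2 * pi^-1 * 0 : R).
  apply: cvgM.
    by apply: cvgMl_tmp; exact: cvg_natr_central_ratio_sqr.
  by have := cvg_central_ratio0 R; rewrite -(cvg_shiftn M).
rewrite mulr0 in h; apply: (squeeze_cvgr _ (cvg_cst 0) h).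
apply: nearW => n; rewrite normr_ge0 /= (addnC n).
have aM := central_ratio_gt0 R M; have an := central_ratio_gt0 R n.
have anM := central_ratio_gt0 R (M + n).
set X := 2 * n%:R * (central_ratio R M * central_ratio R (M + n) *
    central_ratio R n ^+ 2) / 'C(M + n, n)%:R.
have X0 : 0 <= X.
  apply: divr_ge0 => //; apply: mulr_ge0 => //.
  by rewrite ltW// pmulr_rgt0 ?exprn_gt0// pmulr_rgt0.
have -> : bauer_cert R M n = (-1) ^+ n * X by rewrite /bauer_cert /X; ring.
rewrite normrM normr_sign mul1r ger0_norm// {X0}/X.
rewrite ler_pdivrMr ?ltr0n ?bin_gt0 ?leq_addl//.
have c1 : 1 <= 'C(M + n, n)%:R :> R by rewrite ler1n bin_gt0 leq_addl.
have := central_ratio_le1 R M.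
have : 0 <= 2 * n%:R * central_ratio R (M + n) * central_ratio R n ^+ 2.
  by rewrite !mulr_ge0// ?exprn_ge0 ltW.
set t := _ * _ ^+ 2 => t0 aM1.
rewrite [leLHS](_ : _ = central_ratio R M * t); last by rewrite /t; ring.
rewrite [leRHS](_ : _ = t * 'C(M + n, n)%:R); last by rewrite /t; ring.
nra.
Qed.

(** Summing the WZ identity over k telescopes to [bauer_cert R M n], which tends to 0. The statement
    compares partial sums because convergence of either series is not yet known. *)
Lemma bauer_sum_shift (R : realType) M :
  \sum_(0 <= k < n) bauer_term R M k - \sum_(0 <= k < n) bauer_term R 0 k
    @[n --> \oo] --> (0 : R).
Proof.
elim: M => [|M IHM]; first by under eq_fun do rewrite subrr; exact: cvg_cst.
have h := cvgD (cvg_bauer_cert0 R M) IHM; rewrite addr0 in h.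
rewrite (_ : (fun n => _) = bauer_cert R M + (fun n =>
  \sum_(0 <= k < n) bauer_term R M k -
  \sum_(0 <= k < n) bauer_term R 0 k)); first exact: h.
apply/funext => n; rewrite fctE.
suff <- : \sum_(0 <= k < n) bauer_term R M.+1 k - \sum_(0 <= k < n) bauer_term R M k
    = bauer_cert R M n by rewrite addrA subrK.
rewrite -sumrB (eq_bigr _ (fun k _ => bauer_wz R M k)) telescope_sumr//.
by rewrite /bauer_cert mulr0 mulr0 mul0r mul0r subr0.
Qed.

(* Makes the tail of the shifted series O(a_M), by comparison with sum 1/(k(k+1)). *)
Lemma bin_addS_lower_bound M k : (2 < M)%N ->
  ((M + k.+1) * (k.+2 * k.+3) <= 6 * 'C(M + k.+1, k.+1))%N.
Proof.
move=> M3.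
have e := mul_bin_diag (M + k.+1) k; rewrite addnS /= -addnS in e.
have le3 : ('C(3 + k, k) <= 'C(M + k, k))%N by rewrite leq_bin2l ?leq_add2r.
have {le3} : (k.+1 * (k.+2 * k.+3) <= 6 * 'C(M + k, k))%N.
  apply: leq_trans (_ : 6 * 'C(3 + k, k) <= _)%N; last by rewrite leq_mul2l.
  have := bin_ffact (3 + k) 3; rewrite -(bin_sub (leq_addr k 3)) addKn.
  by rewrite !ffactnS ffactn0 /= !factS fact0 => h; lia.
move=> h; rewrite -(@leq_pmul2l k.+1)// [leqRHS]mulnCA -e; nia.
Qed.

(** Uniformity in n is the point: as M grows, only the term k = 0 survives, and it equals (2M+1)
    a_M^2, the Wallis sequence. *)
Lemma bauer_tail_bound (R : realType) M n : (2 < M)%N ->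
  `|\sum_(0 <= k < n) bauer_term R M k.+1| <= 15 * central_ratio R M.
Proof.
move=> M3; apply: le_trans (ler_norm_sum _ _ _) _.
have aM := central_ratio_gt0 R M.
(* As 2M+4k+5 <= 5(M+k+1), the factor 6 of [bin_addS_lower_bound] bounds each term by 30 a_M /
   ((k+2)(k+3)), written here as a telescoping difference; the sum is at most 30 a_M / 2. *)
apply: (@le_trans _ _ (\sum_(0 <= k < n)
    (- (30 * central_ratio R M / (k.+1%:R + 2)) -
     - (30 * central_ratio R M / (k%:R + 2))))).
  apply: ler_sum => k _.
  have aMk := central_ratio_gt0 R (M + k.+1); have ak := central_ratio_gt0 R k.+1.
  have aMk1 := central_ratio_le1 R (M + k.+1); have ak1 := central_ratio_le1 R k.+1.
  have c0 : 0 < 'C(M + k.+1, k.+1)%:R :> R by rewrite ltr0n bin_gt0 leq_addl.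
  set t := (2 * M%:R + 4 * k.+1%:R + 1) * (central_ratio R M *
    central_ratio R (M + k.+1) * central_ratio R k.+1 ^+ 2) / 'C(M + k.+1, k.+1)%:R.
  have -> : bauer_term R M k.+1 = (-1) ^+ k.+1 * t by rewrite /bauer_term /t; ring.
  have k0 := ler0n R k; have M0 := ler0n R M.
  have p0 : 0 < central_ratio R M * central_ratio R (M + k.+1) *
      central_ratio R k.+1 ^+ 2.
    by rewrite pmulr_rgt0 ?exprn_gt0// pmulr_rgt0.
  have pM : central_ratio R M * central_ratio R (M + k.+1) * central_ratio R k.+1 ^+ 2 <=
      central_ratio R M.
    rewrite -mulrA ler_piMr ?(ltW aM)// mulr_ile1 ?exprn_ile1 ?exprn_ge0//.
    - exact: ltW.
    - exact: ltW.
    - exact: ltW.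
  have X0 : 0 < 2 * M%:R + 4 * k.+1%:R + 1 :> R by rewrite -natr1; lra.
  rewrite normrM normr_sign mul1r ger0_norm; last first.
    by apply: divr_ge0; [apply: mulr_ge0; exact: ltW | exact: ltW].
  rewrite ler_pdivrMr//; apply: le_trans (ler_wpM2l (ltW X0) pM) _.
  have := bin_addS_lower_bound M k M3; rewrite -(ler_nat R) !natrM natrD => hC.
  have -> : - (30 * central_ratio R M / (k.+1%:R + 2)) -
      - (30 * central_ratio R M / (k%:R + 2)) =
      30 * central_ratio R M / ((k%:R + 2) * (k%:R + 3)).
    by rewrite -natr1; field; rewrite !lt0r_neq0//; lra.
  rewrite mulrAC ler_pdivlMr; last by rewrite mulr_gt0//; lra.
  rewrite mulrAC [leRHS]mulrAC ler_pM2r//; nra.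
rewrite telescope_sumr// opprK add0r.
have : 0 <= 30 * central_ratio R M / (n%:R + 2).
  by rewrite divr_ge0 ?mulr_ge0 ?addr_ge0// ltW.
lra.
Qed.

Lemma bauer (R : realType) :
  series (fun n => (-1) ^+ n * (4 * n%:R + 1) * central_ratio R n ^+ 3)
    @ \oo --> 2 / pi.
Proof.
have -> : (fun n => (-1) ^+ n * (4 * n%:R + 1) * central_ratio R n ^+ 3) =
    bauer_term R 0.
  apply/funext => n.
  by rewrite /bauer_term add0n binn central_ratio0 mulr0 add0r divr1 mul1r -exprS.
apply/cvgrPdist_le => e e0.
have e3 : 0 < e / 3 by rewrite divr_gt0.
have /cvgrPdist_le/(_ _ e3)[N1 _ hN1] := wallis R.
(* The tail bound 15 a_M then costs at most e/3. The summand 3 in [M] below meets the hypothesis of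
   [bauer_tail_bound]. *)
have /cvgrPdist_le/(_ (e / 45))[|N2 _ hN2] := cvg_central_ratio0 R.
  by rewrite divr_gt0.
pose M := (N1 + N2 + 3)%N.
have {hN1}h1 := hN1 M (leq_trans (leq_addr _ _) (leq_addr _ _)).
have {hN2}h2 := hN2 M (leq_trans (leq_addl _ _) (leq_addr _ _)).
have /cvgrPdist_le/(_ _ e3) := bauer_sum_shift R M.
move=> h3; near=> n.
have h4 : `|0 - (\sum_(0 <= k < n) bauer_term R M k -
  \sum_(0 <= k < n) bauer_term R 0 k)| <= e / 3 by near: n; exact: h3.
have n0 : (0 < n)%N by near: n; exists 1%N.
move: h1 h2; rewrite /= sub0r normrN (ger0_norm (ltW (central_ratio_gt0 R M))) => h1 h2.
have := bauer_tail_bound R M n.-1 (leq_addl _ _).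
have hS : \sum_(0 <= k < n) bauer_term R M k = (2 * M%:R + 1) * central_ratio R M ^+ 2 +
   \sum_(0 <= k < n.-1) bauer_term R M k.+1.
  rewrite -{1}(prednK n0) big_nat_recl//; congr (_ + _).
  rewrite /bauer_term bin0 central_ratio0 addn0 expr0 mul1r mulr0 addr0 divr1.
  by rewrite expr1n mulr1 -expr2.
move: h4 h1 h2; rewrite hS /series /=.
move: (\sum_(0 <= k < n.-1) _) (\sum_(0 <= k < n) _) => x y.
move: (central_ratio R M) (2 / pi) (M%:R) => a q m.
rewrite !ler_norml => /andP[? ?] /andP[? ?] ? /andP[? ?]; apply/andP; split; lra.
Unshelve. all: by end_near.
Qed.

(** * Rational sums and telescoping *)

(** A boolean predicate closed under the field operations, so that [rpred] lemmas settle the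
    rationality of all coefficients. *)
Definition rational {R : realType} : {pred R} :=
  fun x => `[< exists q : rat, x = ratr q >].

Lemma rational_divring_closed (R : realType) : divring_closed (@rational R).
Proof.
split=> [|x y|x y].
- by apply/asboolP; exists 1; rewrite rmorph1.
- by move=> /asboolP[q ->] /asboolP[r ->]; apply/asboolP; exists (q - r); rewrite rmorphB.
- move=> /asboolP[q ->] /asboolP[r ->]; apply/asboolP; exists (q / r).
  by rewrite fmorph_div.
Qed.

HB.instance Definition _ (R : realType) :=
  GRing.isDivringClosed.Build R (@rational R) (@rational_divring_closed R).

Definition has_rational_sum {R : realType} (c : R) (u : R^nat) : Prop :=
  exists2 x, x \in rational & series u @ \oo --> x * c.

Lemma has_rational_sumE (R : realType) (c : R) u :
  has_rational_sum c u -> sum_is_rational_multiple u c.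
Proof.
move=> [x /asboolP[q ->] h]; split; first by apply/cvg_ex; exists (ratr q * c).
by exists q; apply/cvg_lim.
Qed.

Lemma has_rational_sum_lin (R : realType) (c a b : R) u v :
  a \in rational -> b \in rational ->
  has_rational_sum c u -> has_rational_sum c v ->
  has_rational_sum c (fun n => a * u n + b * v n).
Proof.
move=> aQ bQ [x xQ hx] [y yQ hy]; exists (a * x + b * y).
  by rewrite rpredD ?rpredM.
rewrite (_ : series _ = (fun n => a * series u n + b * series v n)).
  rewrite mulrDl -!mulrA.
  by apply: cvgD; apply: cvgMl_tmp.
by apply/funext => n; rewrite /series /= big_split /= -!mulr_sumr.
Qed.

Lemma has_rational_sum_scale (R : realType) (c a : R) u : a \in rational ->
  has_rational_sum c u -> has_rational_sum c (fun n => a * u n).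
Proof.
move=> aQ h; have := has_rational_sum_lin R c a 0 u u aQ (rpred0 _) h h.
by under eq_fun do rewrite mul0r addr0.
Qed.

Lemma has_rational_sum_telescope (R : realType) (c x : R) (G : R^nat) :
  x \in rational -> G 0%N = 0 -> G @ \oo --> x * c ->
  has_rational_sum c (fun n => G n.+1 - G n).
Proof.
move=> xQ G0 h; exists x => //.
have -> : series (fun n => G n.+1 - G n) = G; last exact: h.
by apply/funext => n; rewrite /series /= telescope_sumr// G0 subr0.
Qed.

(** The induction step on the pole index: w is a telescoping difference, v gathers the series
    already summed, and u is the pole of the next index. *)
Lemma has_rational_sum_solve (R : realType) (c a b : R) u v w :
  a \in rational -> b \in rational -> a != 0 ->
  has_rational_sum c w -> has_rational_sum c v ->
  (forall n, w n = a * u n + b * v n) -> has_rational_sum c u.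
Proof.
move=> aQ bQ a0 hw hv e.
have -> : u = (fun n => a^-1 * w n + (- (a^-1 * b)) * v n).
  by apply/funext => n; rewrite e; field.
by apply: has_rational_sum_lin; rewrite ?rpredN ?rpredM ?rpredV.
Qed.

(** * Telescoping identities between poles of consecutive index *)

Definition pair_factor (R : realType) (m n : nat) : R :=
  (n%:R + m%:R) * (n%:R - m%:R + 2^-1).

Lemma natr_sub_half_neq0 (R : realType) (m n : nat) :
  n%:R - m%:R + 2^-1 != 0 :> R.
Proof.
apply/eqP => h.
have : (2 * n + 1)%N%:R = (2 * m)%N%:R :> R by rewrite natrD !natrM; lra.
by move/eqP; rewrite eqr_nat => /eqP; lia.
Qed.

Lemma pair_factor_neq0 (R : realType) (m n : nat) :
  (0 < m)%N -> pair_factor R m n != 0.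
Proof.
move=> m0; rewrite mulf_neq0 ?natr_sub_half_neq0//.
by rewrite -natrD pnatr_eq0 addn_eq0 negb_and -!lt0n m0 orbT.
Qed.

Definition cubic_weight (R : realType) (n : nat) : R :=
  (-1) ^+ n * (4 * n%:R + 1) * central_ratio R n ^+ 3.

Definition quartic_weight (R : realType) (n : nat) : R :=
  (4 * n%:R + 1) * central_ratio R n ^+ 4.

(* r_{M+1}(n) of the header. At n = M = 0 the junk value 0 is harmless, because the
   kernel is always multiplied by a positive power of n. *)
Definition step_kernel (R : realType) (M n : nat) : R :=
  ((n%:R - M%:R - 2^-1) * (n%:R + M%:R))^-1.

Lemma step_nonzero (R : realType) (M n : nat) : (0 < n + M)%N ->
  [/\ n%:R + M%:R != 0 :> R, n%:R + (M%:R + 1) != 0 :> R,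
    4 * M%:R + 1 != 0 :> R,
    (n%:R - M%:R) * 2 + 1 != 0 :> R & (n%:R - (M%:R + 1)) * 2 + 1 != 0 :> R].
Proof.
have n0 := ler0n R n; have M0 := ler0n R M.
move=> nM; split; try by rewrite lt0r_neq0//; lra.
- by rewrite -natrD pnatr_eq0 -lt0n.
- by apply: contra_neq (natr_sub_half_neq0 R M n) => h; lra.
- have := natr_sub_half_neq0 R M.+1 n; rewrite -(natr1 M).
  by apply: contra_neq => h; lra.
Qed.

(** As (n+1) a_(n+1) = (n+1/2) a_n, division by a_n^4 leaves rational functions. The denominators of
    the two kernels and those of the two pair factors consist of the same four linear factors,
    paired crosswise. The residues carry n^4 or (n+1/2)^4 at these poles, which gives M^4 and
    (M+1/2)^4. *)
Lemma quartic_telescoping (R : realType) M n :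
  n.+1%:R ^+ 4 * central_ratio R n.+1 ^+ 4 * step_kernel R M n.+1 -
  n%:R ^+ 4 * central_ratio R n ^+ 4 * step_kernel R M n =
  - ((M%:R + 2^-1) ^+ 4 / (4 * M%:R + 1)) * (quartic_weight R n / pair_factor R M.+1 n)
  + M%:R ^+ 4 / (4 * M%:R + 1) * (quartic_weight R n / pair_factor R M n).
Proof.
rewrite /step_kernel /quartic_weight /pair_factor central_ratioS -(natr1 n) -(natr1 M).
have n2 : 2 * n%:R + 2 != 0 :> R by have := ler0n R n => n0; rewrite lt0r_neq0//; lra.
(* At n = M = 0 both the kernel and the pole of index 0 are inverses of 0; their coefficients n^4
   and M^4 vanish, so the identity persists. *)
have [|/(step_nonzero R)[h1 h2 h3 h4 h5]] := posnP (n + M); last first.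
  by field; rewrite n2 h1 h2 h3 h4 h5.
move/eqP; rewrite addn_eq0 => /andP[/eqP-> /eqP->].
by rewrite expr0n /= !(mul0r, addr0); field.
Qed.

(* (4M+1)/2 times this identity is quartic_telescoping differentiated in M. *)
Lemma quartic_sqr_telescoping (R : realType) M n :
  n.+1%:R ^+ 4 * central_ratio R n.+1 ^+ 4 * step_kernel R M n.+1 ^+ 2 -
  n%:R ^+ 4 * central_ratio R n ^+ 4 * step_kernel R M n ^+ 2 =
  - ((M%:R + 2^-1) ^+ 4 * (4 * M%:R + 3) / (4 * M%:R + 1) ^+ 2) *
    (quartic_weight R n / pair_factor R M.+1 n ^+ 2)
  + (M%:R ^+ 4 * (4 * M%:R - 1) / (4 * M%:R + 1) ^+ 2 *
      (quartic_weight R n / pair_factor R M n ^+ 2)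
    + (8 * (M%:R + 2^-1) ^+ 3 * (M%:R + 2^-1 - (4 * M%:R + 1)) / (4 * M%:R + 1) ^+ 3 *
      (quartic_weight R n / pair_factor R M.+1 n)
    + 8 * M%:R ^+ 3 * (3 * M%:R + 1) / (4 * M%:R + 1) ^+ 3 *
      (quartic_weight R n / pair_factor R M n))).
Proof.
rewrite /step_kernel /quartic_weight /pair_factor central_ratioS -(natr1 n) -(natr1 M).
have n2 : 2 * n%:R + 2 != 0 :> R by have := ler0n R n => n0; rewrite lt0r_neq0//; lra.
have [|/(step_nonzero R)[h1 h2 h3 h4 h5]] := posnP (n + M); last first.
  by field; rewrite n2 h1 h2 h3 h4 h5.
move/eqP; rewrite addn_eq0 => /andP[/eqP-> /eqP->].
by rewrite expr0n /= !(mul0r, mulr0, addr0, add0r, invr0); field.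
Qed.

(** With the alternating sign the leading parts of the two terms add up instead of cancelling. The
    polynomial part -(4n+1)/2 that remains is the multiple of Bauer's summand. *)
Lemma cubic_telescoping (R : realType) M n :
  (-1) ^+ n.+1 * n.+1%:R ^+ 3 * central_ratio R n.+1 ^+ 3 * step_kernel R M n.+1 -
  (-1) ^+ n * n%:R ^+ 3 * central_ratio R n ^+ 3 * step_kernel R M n =
  - ((M%:R + 2^-1) ^+ 3 / (4 * M%:R + 1)) * (cubic_weight R n / pair_factor R M.+1 n)
  + (- (M%:R ^+ 3 / (4 * M%:R + 1)) * (cubic_weight R n / pair_factor R M n)
     + - 2^-1 * cubic_weight R n).
Proof.
rewrite /step_kernel /cubic_weight /pair_factor central_ratioS (exprS (-1) n)
  -(natr1 n) -(natr1 M).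
have n2 : 2 * n%:R + 2 != 0 :> R by have := ler0n R n => n0; rewrite lt0r_neq0//; lra.
have [|/(step_nonzero R)[h1 h2 h3 h4 h5]] := posnP (n + M); last first.
  by field; rewrite n2 h1 h2 h3 h4 h5.
move/eqP; rewrite addn_eq0 => /andP[/eqP-> /eqP->].
by rewrite !expr0n /= !(mul0r, mulr0, addr0, add0r, oppr0, invr0); field.
Qed.

(** * Boundary values and sums over a single pole *)

Lemma cvg_step_kernel (R : realType) M :
  n%:R ^+ 2 * step_kernel R M n @[n --> \oo] --> (1 : R).
Proof.
have h := cvgM (cvg_natr_shift_ratio R (- M%:R - 2^-1)) (cvg_natr_shift_ratio R M%:R).
rewrite mulr1 in h.
rewrite (_ : (fun n => _) = (fun n => n%:R / (n%:R + (- M%:R - 2^-1))) \*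
  (fun n => n%:R / (n%:R + M%:R))); first exact: h.
by apply/funext => n; rewrite /step_kernel /= invfM !addrA; ring.
Qed.

Lemma has_rational_sum0 (R : realType) (c : R) : has_rational_sum c (fun=> 0).
Proof.
exists 0; first exact: rpred0.
rewrite mul0r (_ : series _ = fun=> 0); first exact: cvg_cst.
by apply/funext => n; rewrite /series /= big1.
Qed.

(** Lets the inductions over poles start at index 1: one factor M of the coefficient is kept with
    the pole of index M, about which nothing is known at M = 0. *)
Lemma has_rational_sum_natmul (R : realType) (c : R) (M : nat) u :
  ((0 < M)%N -> has_rational_sum c u) -> has_rational_sum c (fun n => M%:R * u n).
Proof.
case: M => [_|M h]; last by apply: has_rational_sum_scale (rpred_nat _ _) (h _).
by under eq_fun do rewrite mul0r; exact: has_rational_sum0.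
Qed.

(** The sequence is (n a_n^2)^2 times n^2 r(n). The limit is displayed as a rational times the
    constant, as [has_rational_sum_telescope] expects. *)
Lemma quartic_cert_cvg (R : realType) M :
  n%:R ^+ 4 * central_ratio R n ^+ 4 * step_kernel R M n
    @[n --> \oo] --> 1 * (pi ^+ 2)^-1.
Proof.
rewrite mulrC -exprVn expr2 (_ : (fun n => _) = (fun n =>
  (n%:R * central_ratio R n ^+ 2) * (n%:R * central_ratio R n ^+ 2) *
  (n%:R ^+ 2 * step_kernel R M n))); last by apply/funext => n; ring.
apply: cvgM; last exact: cvg_step_kernel.
by apply: cvgM; exact: cvg_natr_central_ratio_sqr.
Qed.

Lemma quartic_sqr_cert_cvg (R : realType) M :
  n%:R ^+ 4 * central_ratio R n ^+ 4 * step_kernel R M n ^+ 2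
    @[n --> \oo] --> 0 * (pi ^+ 2)^-1.
Proof.
have -> : 0 * (pi ^+ 2)^-1 = 0 * 0 * (0 * 0) * (1 * 1) :> R by rewrite !mul0r.
rewrite (_ : (fun n => _) = (fun n => central_ratio R n * central_ratio R n *
  (central_ratio R n * central_ratio R n) *
  ((n%:R ^+ 2 * step_kernel R M n) * (n%:R ^+ 2 * step_kernel R M n)))); last first.
  by apply/funext => n; ring.
have a0 := cvg_central_ratio0 R; have k1 := cvg_step_kernel R M.
by do ![apply: cvgM => //].
Qed.

Lemma cubic_cert_cvg (R : realType) M :
  (-1) ^+ n * n%:R ^+ 3 * central_ratio R n ^+ 3 * step_kernel R M n
    @[n --> \oo] --> 0 * pi^-1.
Proof.
rewrite mul0r; apply/norm_cvg0P.
rewrite (_ : (fun n => _) = (fun n => `|(n%:R * central_ratio R n ^+ 2) *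
  central_ratio R n * (n%:R ^+ 2 * step_kernel R M n)|)); last first.
  by apply/funext => n; rewrite /= -[RHS](normrMsign n); congr `|_|; ring.
apply/norm_cvg0P; rewrite -(mul0r 1) -(mulr0 pi^-1).
apply: cvgM; last exact: cvg_step_kernel.
by apply: cvgM; [exact: cvg_natr_central_ratio_sqr | exact: cvg_central_ratio0].
Qed.

Lemma step_coef_neq0 (R : realType) M :
  M%:R + 2^-1 != 0 :> R /\ 4 * M%:R + 1 != 0 :> R.
Proof. by have := ler0n R M; split; rewrite lt0r_neq0//; lra. Qed.

Lemma quartic_simple_pole (R : realType) m : (0 < m)%N ->
  has_rational_sum (pi ^+ 2)^-1 (fun n => quartic_weight R n / pair_factor R m n).
Proof.
elim: m => // M IHM _.
have [h1 h2] := step_coef_neq0 R M.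
apply: (has_rational_sum_solve _ _ (- ((M%:R + 2^-1) ^+ 4 / (4 * M%:R + 1)))
  (M%:R ^+ 3 / (4 * M%:R + 1)) _
  (fun n => M%:R * (quartic_weight R n / pair_factor R M n))
  (fun n => n.+1%:R ^+ 4 * central_ratio R n.+1 ^+ 4 * step_kernel R M n.+1 -
    n%:R ^+ 4 * central_ratio R n ^+ 4 * step_kernel R M n)).
- by rewrite rpredN rpred_div ?rpredX ?rpredD ?rpredV ?rpredM ?rpred_nat ?rpred1.
- by rewrite rpred_div ?rpredX ?rpredD ?rpredM ?rpred_nat ?rpred1.
- by rewrite oppr_eq0 mulf_neq0 ?invr_eq0 ?expf_neq0.
- apply: has_rational_sum_telescope (rpred1 _) _ (quartic_cert_cvg R M).
  by rewrite expr0n !mul0r.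
- exact: has_rational_sum_natmul.
- by move=> n; rewrite quartic_telescoping exprSr; ring.
Qed.

Lemma quartic_double_pole (R : realType) m : (0 < m)%N ->
  has_rational_sum (pi ^+ 2)^-1
    (fun n => quartic_weight R n / pair_factor R m n ^+ 2).
Proof.
elim: m => // M IHM _.
have [h1 h2] := step_coef_neq0 R M.
have h3 : 4 * M%:R + 3 != 0 :> R by rewrite -natrM -natrD pnatr_eq0 addn_eq0 andbF.
(* Here v combines the double pole of index M with the simple poles of indices M+1 and M, the latter
   two summed by [quartic_simple_pole]. *)
apply: (has_rational_sum_solve _ _
  (- ((M%:R + 2^-1) ^+ 4 * (4 * M%:R + 3) / (4 * M%:R + 1) ^+ 2)) 1
  _ (fun n => M%:R ^+ 3 * (4 * M%:R - 1) / (4 * M%:R + 1) ^+ 2 *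
      (M%:R * (quartic_weight R n / pair_factor R M n ^+ 2))
    + 1 * (8 * (M%:R + 2^-1) ^+ 3 * (M%:R + 2^-1 - (4 * M%:R + 1)) / (4 * M%:R + 1) ^+ 3 *
      (quartic_weight R n / pair_factor R M.+1 n)
    + 8 * M%:R ^+ 2 * (3 * M%:R + 1) / (4 * M%:R + 1) ^+ 3 *
      (M%:R * (quartic_weight R n / pair_factor R M n))))
  (fun n => n.+1%:R ^+ 4 * central_ratio R n.+1 ^+ 4 * step_kernel R M n.+1 ^+ 2 -
    n%:R ^+ 4 * central_ratio R n ^+ 4 * step_kernel R M n ^+ 2)).
- by rewrite rpredN rpred_div ?rpredM ?rpredX ?rpredD ?rpredV ?rpredM ?rpred_nat ?rpred1.
- exact: rpred1.
- by rewrite oppr_eq0 !mulf_neq0 ?invr_eq0 ?expf_neq0.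
- apply: has_rational_sum_telescope (rpred0 _) _ (quartic_sqr_cert_cvg R M).
  by rewrite expr0n !mul0r.
- apply: has_rational_sum_lin.
  + by rewrite !(rpred_div, rpredM, rpredX, rpredB, rpredD, rpredV, rpred_nat, rpred1).
  + exact: rpred1.
  + exact: has_rational_sum_natmul.
  + apply: has_rational_sum_lin.
    * by rewrite !(rpred_div, rpredM, rpredX, rpredB, rpredD, rpredV, rpred_nat, rpred1).
    * by rewrite !(rpred_div, rpredM, rpredX, rpredB, rpredD, rpredV, rpred_nat, rpred1).
    * exact: quartic_simple_pole.
    * by apply: has_rational_sum_natmul; exact: quartic_simple_pole.
- by move=> n; rewrite quartic_sqr_telescoping; ring.
Qed.

Lemma cubic_sum (R : realType) : has_rational_sum pi^-1 (cubic_weight R).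
Proof. by exists 2; [exact: rpred_nat | exact: bauer]. Qed.

Lemma cubic_simple_pole (R : realType) m : (0 < m)%N ->
  has_rational_sum pi^-1 (fun n => cubic_weight R n / pair_factor R m n).
Proof.
elim: m => // M IHM _.
have [h1 h2] := step_coef_neq0 R M.
apply: (has_rational_sum_solve _ _ (- ((M%:R + 2^-1) ^+ 3 / (4 * M%:R + 1))) 1
  _ (fun n => - (M%:R ^+ 2 / (4 * M%:R + 1)) *
      (M%:R * (cubic_weight R n / pair_factor R M n)) + - 2^-1 * cubic_weight R n)
  (fun n =>
    (-1) ^+ n.+1 * n.+1%:R ^+ 3 * central_ratio R n.+1 ^+ 3 * step_kernel R M n.+1 -
    (-1) ^+ n * n%:R ^+ 3 * central_ratio R n ^+ 3 * step_kernel R M n)).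
- by rewrite rpredN rpred_div ?rpredX ?rpredD ?rpredV ?rpredM ?rpred_nat ?rpred1.
- exact: rpred1.
- by rewrite oppr_eq0 mulf_neq0 ?invr_eq0 ?expf_neq0.
- apply: has_rational_sum_telescope (rpred0 _) _ (cubic_cert_cvg R M).
  by rewrite expr0n mulr0 !mul0r.
- apply: has_rational_sum_lin.
  + by rewrite rpredN rpred_div ?rpredX ?rpredD ?rpredV ?rpredM ?rpred_nat ?rpred1.
  + by rewrite rpredN rpredV rpred_nat.
  + exact: has_rational_sum_natmul.
  + exact: cubic_sum.
- by move=> n; rewrite cubic_telescoping; ring.
Qed.

(** * Reduction to simple and double poles *)

(** Partial fractions by induction on the length of s. If all indices agree, the product is a power
    of exponent at most b. Otherwise two distinct indices x, y give 1/(D_x D_y) = (1/D_x -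
    1/D_y)/(D_y - D_x), and each resulting product has one factor less. *)
Lemma has_rational_sum_prod (R : realType) (c : R) (w : R^nat) (b : nat) :
  (forall m j, (0 < m)%N -> (0 < j <= b)%N ->
    has_rational_sum c (fun n => w n / pair_factor R m n ^+ j)) ->
  forall s : seq nat, s != [::] -> all (leq 1) s ->
    (forall m, (count_mem m s <= b)%N) ->
    has_rational_sum c (fun n => w n / \prod_(m <- s) pair_factor R m n).
Proof.
move=> hw s; have [k] := ubnP (size s).
elim: k s => // k IHk [//|x s] /= sk _ /andP[x0 s0] sb.
have [sx|] := boolP (all (pred1 x) s).
  have prodE n : \prod_(m <- x :: s) pair_factor R m n = pair_factor R x n ^+ (size s).+1.
    by rewrite big_cons {1}(all_pred1P _ _ sx) big_nseq iter_mulr_1 exprS.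
  under eq_fun do rewrite prodE; apply: hw => //=.
  by have := sb x; rewrite /= eqxx; move: sx; rewrite all_count => /eqP->.
rewrite -has_predC => /hasP[y ys /= yx].
have y0 : (0 < y)%N by exact: (allP s0).
have sE := perm_to_rem ys; set t := rem y s in sE.
have st : size s = (size t).+1 by rewrite (perm_size sE).
have t0 : all (leq 1) t by move: s0; rewrite (perm_all _ sE) /= => /andP[].
have tb m : ((x == m) + ((y == m) + count_mem m t) <= b)%N.
  by have := sb m; rewrite /= (permP sE).
have hx : has_rational_sum c (fun n => w n / \prod_(m <- x :: t) pair_factor R m n).
  apply: IHk => //=; rewrite -?st ?x0//.
  by move=> m; apply: leq_trans (tb m); rewrite leq_add2l leq_addl.
have hy : has_rational_sum c (fun n => w n / \prod_(m <- y :: t) pair_factor R m n).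
  apply: IHk => //=; rewrite -?st ?y0//.
  by move=> m; apply: leq_trans (tb m); rewrite leq_addl.
(* This is D_y(n) - D_x(n), free of n; it is nonzero because x and y are distinct and both at least
   1. *)
pose d : R := (x%:R - y%:R) * (x%:R + y%:R - 2^-1).
have d0 : d != 0.
  have x1 : 1 <= x%:R :> R by rewrite ler1n.
  have y1 : 1 <= y%:R :> R by rewrite ler1n.
  rewrite mulf_neq0//; last by rewrite lt0r_neq0//; lra.
  by rewrite subr_eq0 eqr_nat eq_sym.
have dQ : d^-1 \in rational.
  by rewrite rpredV rpredM ?rpredB ?rpredD ?rpredV ?rpred_nat.
have dNQ : - d^-1 \in rational by rewrite rpredN.
have := has_rational_sum_lin _ _ _ _ _ _ dQ dNQ hx hy.
congr has_rational_sum; apply/funext => n.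
rewrite !big_cons (perm_big _ sE) big_cons.
have := pair_factor_neq0 R y n y0; have := pair_factor_neq0 R x n x0.
have : \prod_(m <- t) pair_factor R m n != 0.
  by rewrite prodf_seq_neq0; apply: sub_all t0 => m; exact: pair_factor_neq0.
have dE : d = pair_factor R y n - pair_factor R x n by rewrite /d /pair_factor; ring.
rewrite {}dE in d0 * => /=.
move: (pair_factor R x n) (pair_factor R y n) (\prod_(m <- t) _) d0 => X Y P h hP hX hY.
by field; rewrite h hP hX hY.
Qed.

(** * Factorization of p from its roots *)

Lemma exists_preimage_seq (T : eqType) (f : nat -> T) (s : seq T) :
  injective f -> exists2 r, uniq r & forall m, (m \in r) = (f m \in s).
Proof.
move=> f_inj; suff [r hr] : exists r : seq nat, forall m, (m \in r) = (f m \in s).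
  by exists (undup r); [exact: undup_uniq | move=> m; rewrite mem_undup].
elim: s => [|z s [r IH]]; first by exists [::].
have [[m ->]|nz] := pselect (exists m, z = f m).
  by exists (m :: r) => k; rewrite !inE IH (inj_eq f_inj).
exists r => k; rewrite inE IH; case: eqVneq => // e; case: nz; by exists k.
Qed.

(** The map z -> -1/2 - z permutes the complex roots and exchanges [f m] with [g m]. The roots being
    simple and admissible, they are listed once each by [f] and [g] over one index set. *)
Lemma admissible_factorization (R : realType) (p : {poly int}) :
  simple_admissible_roots R p -> reflection_invariant p ->
  exists2 S : seq nat, uniq S && all (leq 1) S &
    size p = (2 * size S).+1 /\
    forall n : nat, (p.[n%:Z])%:~R =
      (lead_coef p)%:~R * \prod_(m <- S) pair_factor R m n.
Proof.
move=> proots psym.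
pose f (m : nat) : R[i] := - m.+1%:R; pose g (m : nat) : R[i] := m%:R + 2^-1.
pose pC : {poly R[i]} := map_poly intr p.
have fg m k : f m != g k.
  apply/eqP => h.
  have : (2 * m.+1 + 2 * k + 1)%N%:R = 0 :> R[i].
    by rewrite !natrD !natrM -[m.+1%:R]opprK -/(f m) h /g; field.
  by move=> /eqP; rewrite pnatr_eq0 addn1.
have adm z : root pC z -> admissible z by move=> /proots[].
have p0 : p != 0.
  apply/eqP => p0.
  have : @admissible R 0 by apply: adm; rewrite /pC p0 rmorph0 root0.
  case=> -[m m0]; first by move/eqP: m0; rewrite eq_sym oppr_eq0 pnatr_eq0.
  have : (2 * m + 1)%N%:R = 2 * (m%:R + 2^-1) :> R[i] by rewrite natrD natrM; field.
  by rewrite -m0 mulr0 => /eqP; rewrite pnatr_eq0 addn1.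
have sizepC : size pC = size p by rewrite size_map_inj_poly//; exact: intr_inj.
have pC0 : pC != 0 by rewrite -size_poly_eq0 sizepC size_poly_eq0.
have lead_pC : lead_coef pC = (lead_coef p)%:~R.
  by rewrite lead_coef_map_inj//; exact: intr_inj.
have [s pCE] := closed_field_poly_normal pC.
have l0 : lead_coef pC != 0 by rewrite lead_coef_eq0.
have rootE z : root pC z = (z \in s) by rewrite pCE rootZ// root_prod_XsubC.
have us : uniq s.
  apply: count_mem_uniq => z; rewrite -mu_prod_XsubC -rootE.
  have <- : mup z pC = mup z (\prod_(y <- s) ('X - y%:P)).
    by rewrite {1}pCE -mul_polyC mupMr// rootC.
  have [/proots[]//|nz] := boolP (root pC z).
  by rewrite mupNroot.
have sym z : (- 2^-1 - z \in s) = (z \in s).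
  rewrite -!rootE.
  (* The reflection identity is carried from Q[x] to the complex polynomials along [ratr]. *)
  have e : pC = pC \Po (- (2^-1)%:P - 'X).
    pose r : {rmorphism rat -> R[i]} := ratr.
    have rE : map_poly r (map_poly intr p) = pC.
      by rewrite -map_poly_comp; apply: eq_map_poly => k /=; rewrite ratr_int.
    have := congr1 (map_poly r) psym; rewrite rE map_comp_poly rE => {1}->.
    by rewrite rmorphB rmorphN /= map_polyX map_polyC /= fmorphV rmorph_nat.
  by rewrite [in RHS]e /root horner_comp !hornerE.
have gE m : g m = - 2^-1 - f m by rewrite /g /f opprK -(natr1 m); field.
have f_inj : injective f by move=> m k /oppr_inj/eqP; rewrite eqr_nat => /eqP[].
have [S uS SE] := exists_preimage_seq _ f s f_inj.
have g_inj : injective g by move=> m k; rewrite !gE => /addrI/oppr_inj/f_inj.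
have sE : perm_eq s (map f S ++ map g S).
  apply: uniq_perm => // [|z].
    rewrite cat_uniq !map_inj_uniq// uS andbT.
    apply/hasPn => _ /mapP[k _ ->]; apply/mapP => -[m _ /esym/eqP].
    by rewrite (negPf (fg _ _)).
  rewrite mem_cat; apply/idP/orP => [zs|[] /mapP[m mS ->]].
  - have [[m zE]|[m zE]] : admissible z by apply: adm; rewrite rootE.
      by left; rewrite zE; apply: map_f; rewrite SE /f -zE.
    by right; rewrite zE; apply: map_f; rewrite SE -sym -gE /g -zE.
  - by rewrite -SE.
  - by rewrite gE sym -SE.
(* The index m of [f m] = -(m+1) corresponds to the pair factor of index m+1. *)
exists (map succn S); first by rewrite (map_inj_uniq succn_inj) uS all_map; exact/allP.
split.
  rewrite -sizepC pCE size_scale// size_prod_XsubC (perm_size sE) size_cat !size_map.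
  by rewrite addnn mul2n.
move=> n; pose i : {rmorphism R -> R[i]} := real_complex R.
apply: (fmorph_inj i); rewrite rmorphM !rmorph_int.
have -> : (p.[n%:Z])%:~R = pC.[n%:R] :> R[i].
  by rewrite -[n%:R]/((n%:Z)%:~R : R[i]) horner_map.
rewrite pCE hornerZ lead_pC; congr (_ * _).
rewrite horner_prod (perm_big _ sE) big_cat /= !big_map -big_split rmorph_prod /=.
apply: eq_bigr => m _; rewrite !hornerXsubC /pair_factor /f /g.
rewrite -[real_complex R]/(i : R -> R[i]) rmorphM !rmorphD rmorphN fmorphV !rmorph_nat.
by rewrite -(natr1 m); field.
Qed.

(* When p is a nonzero constant, both series with fourth powers diverge (their
   terms are of order 1/n), so their claims are made for nonconstant p; the
   claim about the alternating series is made for every p. *)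
Theorem corollary1 (R : realType) (p : {poly int})
  (p_even_degree : ~~ odd (size p).-1)
  (p_roots : simple_admissible_roots R p)
  (p_sym : reflection_invariant p) :
  sum_is_rational_multiple (cubic_term R p) (pi^-1) /\
  ((1 < size p)%N ->
     sum_is_rational_multiple (quartic_term R p 2) ((pi ^+ 2)^-1) /\
     sum_is_rational_multiple (quartic_term R p 1) ((pi ^+ 2)^-1)).
Proof.
have [S /andP[uS S0] [sizep pE]] := admissible_factorization R p p_roots p_sym.
have cQ k : ((lead_coef p)%:~R ^+ k)^-1 \in @rational R.
  by rewrite rpredV rpredX ?rpred_int.
have S1 m : (count_mem m S <= 1)%N by rewrite count_uniq_mem// leq_b1.
(* The list [S ++ S] encodes p^2: its multiplicities are at most 2, so double poles suffice. An
   empty [S] leaves Bauer's series in the cubic case. *)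
have [hc hq] : has_rational_sum pi^-1
      (fun n => cubic_weight R n / \prod_(m <- S) pair_factor R m n) /\
    (S != [::] -> forall T, (T == S) || (T == S ++ S) -> has_rational_sum (pi ^+ 2)^-1
      (fun n => quartic_weight R n / \prod_(m <- T) pair_factor R m n)).
  split=> [|Sn T TE].
    have [->|Sn] := eqVneq S [::].
      by under eq_fun do rewrite big_nil divr1; exact: cubic_sum.
    apply: (has_rational_sum_prod R _ _ 1) => // m j m0.
    rewrite -eqn_leq => /eqP <-; under eq_fun do rewrite expr1.
    exact: cubic_simple_pole.
  apply: (has_rational_sum_prod R _ _ 2).
  - move=> m [|[|[|j]]]// m0 _; last exact: quartic_double_pole.
    by under eq_fun do rewrite expr1; exact: quartic_simple_pole.
  - by case/orP: TE => /eqP->; case: (S) Sn.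
  - by case/orP: TE => /eqP->; rewrite ?all_cat S0.
  - move=> m; case/orP: TE => /eqP->; first by apply: leq_trans (S1 m) _.
    by rewrite count_cat; apply: (leq_add (S1 m) (S1 m)).
split=> [|p1].
  apply: has_rational_sumE; have := has_rational_sum_scale _ _ _ _ (cQ 1) hc.
  congr has_rational_sum; apply/funext => n.
  by rewrite /cubic_term pE natrD natrM invfM /cubic_weight expr1; ring.
have Sn : S != [::] by apply: contraTneq p1 => Snil; rewrite sizep Snil.
split; apply: has_rational_sumE.
  have := has_rational_sum_scale _ _ _ _ (cQ 2) (hq Sn (S ++ S) _).
  rewrite eqxx orbT => /(_ isT); congr has_rational_sum; apply/funext => n.
  by rewrite /quartic_term pE natrD natrM big_cat /= /quartic_weight !expr2 !invfM; ring.
have := has_rational_sum_scale _ _ _ _ (cQ 1) (hq Sn S _).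
rewrite eqxx => /(_ isT); congr has_rational_sum; apply/funext => n.
by rewrite /quartic_term pE natrD natrM !expr1 invfM /quartic_weight; ring.
Qed.
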